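(* Let $I\subset[0,+\infty)$ be an open interval, $n\in\mathbb{N}$, $\beta\in\{-1,1\}$, $N\ge n$, $\xi\in[0,1]$, $t_0\in I$ and $T>0$ fixed with $t_0+\beta T\in I$. Let $\{\varpi(\tau),\tau\ge0\}$ be a continuous parameter stochastic process whose mean value and variance functions are continuous and such that $\varpi(s)$ and $\varpi(t)$ are independent for all $s\neq t$. Sample it with an equidistant sampling period $T_s$, $m=T/T_s\in\mathbb{N}$. If $\kappa,\mu>-\frac12$, then $$\lim_{m\to\infty}\mathrm{Var}\big[e^{\beta T}_{\varpi,m}(t_0)\big]=0 .$$
   Context: For $a,b>-1$ let $w^{a,b}(t)=t^{b}(1-t)^{a}$, $P_k^{a,b}(t)=\sum_{s=0}^{k}\binom{k+a}{s}\binom{k+b}{k-s}(t-1)^{k-s}t^{s}$, $\|P_k^{a,b}\|^2=\int_0^1 w^{a,b}(P_k^{a,b})^2$. With $q=N-n$, the Jacobi estimator kernel is $$p^{\beta T}(\tau)=\frac{(-1)^n}{(\beta T)^n}\sum_{i=0}^{q}\frac{P_i^{\mu+n,\kappa+n}(\xi)}{\|P_i^{\mu+n,\kappa+n}\|^2}\frac{d^n}{d\tau^n}\Big[w^{\mu+n,\kappa+n}(\tau)P_i^{\mu+n,\kappa+n}(\tau)\Big].$$ Discrete noise error contribution: with nodes $t_i=i/m$ and quadrature weights $w_i/m$ ($i=0,\dots,m$) of a numerical integration method on $[0,1]$, $$e^{\beta T}_{\varpi,m}(t_0)=\sum_{i=0}^{m}\frac{w_i}{m}\,p^{\beta T}(t_i)\,\varpi(t_0+\beta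 Tt_i).$$ Standing assumptions on the rule: $w_i>0$ for $0<i<m$, $w_0,w_m\ge0$, with $w_0=0$ when $\kappa<0$ and $w_m=0$ when $\mu<0$ (so that all terms are finite); the weights are bounded uniformly in $i$ and $m$; and the rule is convergent for the integrand $(p^{\beta T})^2$, i.e. $\sum_{i=0}^m\frac{w_i}{m}(p^{\beta T}(t_i))^2\to\int_0^1(p^{\beta T}(t))^2dt$ as $m\to\infty$. *)

(* Defs.v *)
From HB Require Import structures.
From mathcomp Require Import all_boot all_order all_algebra.
From mathcomp Require Import all_classical all_reals all_analysis.
Set Implicit Arguments. Unset Strict Implicit. Unset Printing Implicit Defensive.
Import Order.TTheory GRing.Theory Num.Theory.
Import numFieldNormedType.Exports.
Local Open Scope classical_set_scope.
Local Open Scope ring_scope.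

Section Jacobi.
Variable R : realType.

Definition gbinom (x : R) (s : nat) : R :=
  (\prod_(j < s) (x - j%:R)) / (s`!)%:R.

Definition jweight (a b : R) (t : R) : R := powR t b * powR (1 - t) a.

Definition jacobiP (k : nat) (a b : R) (t : R) : R :=
  \sum_(s < k.+1) gbinom (k%:R + a) s * gbinom (k%:R + b) (k - s)
                  * (t - 1) ^+ (k - s) * t ^+ s.

Definition jnorm2 (k : nat) (a b : R) : R :=
  Rintegral lebesgue_measure `[0, 1]
    (fun t => jweight a b t * (jacobiP k a b t) ^+ 2).

(* the kernel formula, meaningful on the open interval (0,1) *)
Definition jkernel_raw (n N : nat) (mu kappa xi beta T : R) (tau : R) : R :=
  (-1) ^+ n / (beta * T) ^+ n *
  \sum_(i < (N - n).+1)
     (jacobiP i (mu + n%:R) (kappa + n%:R) xi / jnorm2 i (mu + n%:R) (kappa + n%:R)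
      * derive1n n (fun s => jweight (mu + n%:R) (kappa + n%:R) s
                             * jacobiP i (mu + n%:R) (kappa + n%:R) s) tau).

Definition jkernel (n N : nat) (mu kappa xi beta T : R) (tau : R) : R :=
  let f := jkernel_raw n N mu kappa xi beta T in
  if (0 < tau < 1) then f tau
  else if tau <= 0 then lim (f @ 0^'+) else lim (f @ 1^'-).

End Jacobi.

Section Indep.
Context d (T : measurableType d) (R : realType) (P : probability T R).
Definition indep2 (X Y : T -> R) : Prop :=
  forall A B : set R, measurable A -> measurable B ->
    P (X @^-1` A `&` Y @^-1` B) = (P (X @^-1` A) * P (Y @^-1` B))%E.
End Indep.

Definition noise_err {d} {T : measurableType d} {R : realType}
  (p : R -> R) (w : nat -> nat -> R) (varpi : R -> T -> R)
  (t0 beta Tt : R) (m : nat) : T -> R :=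
  fun omega => \sum_(i < m.+1)
     (w m i / m%:R * p (i%:R / m%:R) * varpi (t0 + beta * Tt * (i%:R / m%:R)) omega).

(* Main.v *)
(** Pairwise independent square integrable variables are uncorrelated, so the
    variance of the error is the sum of the (w_i/m)^2 p(t_i)^2 Var(varpi_i). On
    (0,1) each differentiation of a weight times a polynomial lowers both
    exponents of the weight by one, so p is t^kappa (1-t)^mu times a polynomial.
    Put e = max(0, -kappa, -mu) < 1/2. At the interior nodes t (1-t) >= 1/(2m),
    hence p(t_i)^2 = O(m^(2e)), while the two endpoint values of p do not depend
    on m. Summing m+1 terms of order m^(2e-2) gives a variance of order
    m^(2e-1). *)
Require Import Defs.
From HB Require Import structures.
From mathcomp Require Import all_boot all_order all_algebra.
From mathcomp Require Import all_classical all_reals all_analysis measurable_realfun.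
From mathcomp Require Import ring lra.
Import Order.TTheory GRing.Theory Num.Theory.
Import numFieldNormedType.Exports.
Local Open Scope classical_set_scope.
Local Open Scope ring_scope.

(** * The kernel on (0,1) as a weight times a polynomial *)

Lemma jacobiP_poly (R : realType) (k : nat) (a b : R) :
  exists q : {poly R}, forall t, jacobiP k a b t = q.[t].
Proof.
exists (\sum_(s < k.+1) (gbinom (k%:R + a) s * gbinom (k%:R + b) (k - s)) *:
  (('X - 1%:P) ^+ (k - s) * 'X^s)).
move=> t; rewrite /jacobiP horner_sum; apply: eq_bigr => s _.
rewrite hornerZ hornerM horner_exp hornerXn hornerXsubC.
by rewrite -[LHS]mulrA.
Qed.

(** Product rule: differentiating lowers one exponent by at most one, so each of the three terms
    still contains t^b (1-t)^a. *)
Lemma is_derive_jweight_poly (R : realType) (a b t : R) (q : {poly R}) :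
  0 < t < 1 ->
  is_derive t 1 (fun s => jweight (a + 1) (b + 1) s * q.[s])
    (jweight a b t * (((b + 1) *: (1 - 'X) - (a + 1) *: 'X) * q
                     + 'X * (1 - 'X) * q^`()).[t]).
Proof.
move=> /andP[t0 t1].
have t1' : 0 < 1 - t by rewrite subr_gt0.
have d1 : is_derive t 1 (fun s : R => powR (1 - s) (a + 1))
    (- ((a + 1) * (1 - t) `^ (a + 1 - 1))).
  have h : is_derive t 1 (fun s : R => 1 - s) (-1).
    by apply: is_derive_eq; rewrite add0r mul1r.
  have h2 := is_derive1_powR (a + 1) t1'.
  have := @is_derive1_comp _ (fun s : R => powR s (a + 1)) (fun s => 1 - s) t _ _ h2 h.
  by rewrite mulrN1.
have d2 := is_derive1_powR (b + 1) t0.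
have d3 : is_derive t 1 (fun s => q.[s]) q^`().[t].
  exact: is_derive_poly.
have -> : (fun s => jweight (a + 1) (b + 1) s * q.[s]) =
  ((fun s => s `^ (b + 1)) * (fun s => (1 - s) `^ (a + 1)) * (fun s => q.[s])).
  by apply/funext.
apply: is_derive_eq.
rewrite /jweight !addrK fctE.
rewrite !hornerE.
have -> : (1 - t) `^ (a + 1) = (1 - t) * (1 - t) `^ a.
  by rewrite powRD ?powRr1 ?(ltW t1') 1?mulrC//; apply/implyP => _; rewrite gt_eqF.
have -> : t `^ (b + 1) = t * t `^ b.
  by rewrite powRD ?powRr1 ?(ltW t0) 1?mulrC//; apply/implyP => _; rewrite gt_eqF.
rewrite /GRing.scale /=.
ring.
Qed.

Lemma derive1n_jweight_poly (R : realType) (n : nat) (a b : R) (q : {poly R}) :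
  exists r : {poly R}, forall t, 0 < t < 1 ->
    derive1n n (fun s => jweight (a + n%:R) (b + n%:R) s * q.[s]) t
    = jweight a b t * r.[t].
Proof.
elim: n a b => [|n IH] a b; first by exists q => t _; rewrite /= !addr0.
have [r Hr] := IH (a + 1) (b + 1).
exists (((b + 1) *: (1 - 'X) - (a + 1) *: 'X) * r + 'X * (1 - 'X) * r^`()).
move=> t t01; rewrite -addn1 natrD [_%:R + _]addrC !addrA addn1 derive1nS derive1E.
have [_ <-] := is_derive_jweight_poly R a b t r t01.
(* The induction hypothesis holds only on (0,1); this is a neighbourhood of t, which is enough to
   determine the derivative at t. *)
apply: near_eq_derive.
near=> s; apply: Hr.
have : s \in `]0, 1[%R by near: s; apply: near_in_itvoo; rewrite in_itv.
by rewrite in_itv.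
Unshelve. all: by end_near. Qed.

Lemma jkernel_raw_poly (R : realType) (n N : nat) (mu kappa xi beta T : R) :
  exists q : {poly R}, forall t, 0 < t < 1 ->
    jkernel_raw n N mu kappa xi beta T t = jweight mu kappa t * q.[t].
Proof.
have /choice[r Hr] : forall i : nat, exists r : {poly R}, forall t, 0 < t < 1 ->
    derive1n n (fun s => jweight (mu + n%:R) (kappa + n%:R) s
      * jacobiP i (mu + n%:R) (kappa + n%:R) s) t = jweight mu kappa t * r.[t].
  move=> i; have [q Hq] := jacobiP_poly R i (mu + n%:R) (kappa + n%:R).
  by rewrite (funext Hq); exact: derive1n_jweight_poly.
exists (((-1) ^+ n / (beta * T) ^+ n) *: \sum_(i < (N - n).+1)
  (jacobiP i (mu + n%:R) (kappa + n%:R) xi / jnorm2 i (mu + n%:R) (kappa + n%:R))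
   *: r i).
move=> t t01; rewrite /jkernel_raw hornerZ mulrCA; congr (_ * _).
rewrite horner_sum mulr_sumr; apply: eq_bigr => i _.
by rewrite Hr// hornerZ mulrCA.
Qed.

(** * Size of polynomials and weights at the nodes *)

Lemma horner_bounded01 (R : realType) (q : {poly R}) :
  exists B : R, forall t, 0 <= t <= 1 -> `|q.[t]| <= B.
Proof.
have cq : {within `[0, 1], continuous (fun t : R => `|q.[t]|)}.
  apply: continuous_subspaceT => x; apply: cvg_norm; exact: continuous_horner.
have [c _ Hc] := EVT_max ler01 cq.
by exists `|q.[c]| => t t01; apply: Hc; rewrite in_itv.
Qed.

(** Powers of a base in (0,1) decrease in the exponent, so both exponents may be lowered to -e. *)
Lemma jweight_le (R : realType) (a b e t : R) : 0 < t < 1 -> - e <= a -> - e <= b ->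
  jweight a b t <= (t * (1 - t)) `^ (- e).
Proof.
move=> /andP[t0 t1] ea eb.
have t1' : 0 < 1 - t by rewrite subr_gt0.
rewrite powRM ?(ltW t0) ?(ltW t1')//.
by rewrite ler_pM ?powR_ge0// ger_powR// ?t0 ?t1' ?(ltW t1)// gerBl ltW.
Qed.

Lemma jweight_node_le (R : realType) (a b e : R) (m i : nat) :
  0 <= e -> - e <= a -> - e <= b -> (0 < i < m)%N ->
  jweight a b (i%:R / m%:R) <= (2 * m%:R) `^ e.
Proof.
move=> e0 ea eb /andP[i0 im].
have m0 : 0 < m%:R :> R by rewrite ltr0n (leq_trans _ im).
have t0 : 0 < i%:R / m%:R :> R by rewrite divr_gt0// ltr0n.
have t1 : i%:R / m%:R < 1 :> R by rewrite ltr_pdivrMr// mul1r ltr_nat.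
apply: le_trans (jweight_le _ _ _ e _ _ ea eb) _; first by rewrite t0.
have tt0 : 0 < i%:R / m%:R * (1 - i%:R / m%:R) :> R by rewrite mulr_gt0// subr_gt0.
(* t (1 - t) = i (m - i) / m ^ 2 >= (m - 1) / m ^ 2 >= 1 / (2 m) *)
have u1 : 1 <= i%:R / m%:R * (1 - i%:R / m%:R) * (2 * m%:R) :> R.
  have -> : i%:R / m%:R * (1 - i%:R / m%:R) * (2 * m%:R)
          = 2 * i%:R * (m%:R - i%:R) / m%:R :> R by field; rewrite gt_eqF.
  rewrite ler_pdivlMr// mul1r.
  have i1 : 1 <= i%:R :> R by rewrite ler1n.
  have mi1 : i%:R + 1 <= m%:R :> R by rewrite natr1 ler_nat.
  (* The product expands to i (m - i) >= m - 1; since m >= 2, this gives m <= 2 i (m - i). *)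
  have : 0 <= (i%:R - 1) * (m%:R - i%:R - 1) :> R by rewrite mulr_ge0//; lra.
  nra.
(* The claim becomes 1 <= (t (1 - t) 2 m)^e. *)
rewrite powRN -[_^-1]mulr1 ler_pdivrMl ?powR_gt0// -powRM ?(ltW tt0) ?mulr_ge0//.
apply: (@le_trans _ _ (1 `^ e)); first by rewrite powR1.
by apply: ge0_ler_powR; rewrite ?nnegrE ?ler01 ?(le_trans ler01 u1).
Qed.

Lemma cvg_powR_double (R : realType) (s : R) : 0 < s ->
  (2 * m%:R) `^ (- s) @[m --> \oo] --> 0.
Proof.
move=> s0; apply/cvgrPdist_lt => eps eps0; near=> m.
have m0 : 0 < m%:R :> R by rewrite ltr0n; near: m; exact: nbhs_infty_gt.
have M0 : 0 < 2 * m%:R :> R by rewrite mulr_gt0.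
rewrite sub0r normrN ger0_norm ?powR_ge0// powRN.
rewrite invf_plt ?posrE ?powR_gt0//.
(* With 1/eps written as an s-th power, it is enough that m exceeds eps^(-1/s). *)
have -> : eps^-1 = (eps^-1 `^ s^-1) `^ s.
  by rewrite -powRrM mulVf ?gt_eqF// powRr1// invr_ge0 ltW.
rewrite gt0_ltr_powR ?nnegrE ?powR_ge0// ?(ltW M0)//.
apply: (@lt_le_trans _ _ m%:R); last by rewrite ler_peMl ?ltW// ltr1n.
by near: m; exact: nbhs_infty_gtr.
Unshelve. all: by end_near. Qed.

(** * Independence, covariance and the variance of a sum *)

(** By independence the joint law and the product of the laws agree on rectangles, hence everywhere;
    Fubini then splits the integral. *)
Lemma integral_indep (d d1 d2 : measure_display) (T : measurableType d)
  (T1 : measurableType d1) (T2 : measurableType d2)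
  (R : realType) (P : probability T R) (X : {mfun T >-> T1}) (Y : {mfun T >-> T2})
  (f : T1 * T2 -> \bar R) :
  (forall A B, measurable A -> measurable B ->
    P (X @^-1` A `&` Y @^-1` B) = (P (X @^-1` A) * P (Y @^-1` B))%E) ->
  measurable_fun setT f -> P.-integrable setT (fun w => f (X w, Y w)) ->
  (\int[P]_w f (X w, Y w) =
   \int[distribution P X]_x \int[distribution P Y]_y f (x, y))%E.
Proof.
move=> indXY mf intf.
have mZ : measurable_fun setT (fun w => (X w, Y w)).
  by apply/measurable_fun_pair; exact: measurable_funPT.
pose Z : {mfun T >-> (T1 * T2)%type} := HB.pack (fun w => (X w, Y w))
  (isMeasurableFun.Build _ _ _ _ (fun w => (X w, Y w)) mZ).
have prodE A : measurable A ->
    (distribution P X \x distribution P Y)%E A = distribution P Z A.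
  apply: product_measure_unique => A' B mA mB.
  exact: indXY.
have ZE : (\int[distribution P Z]_z f z = \int[P]_w f (X w, Y w))%E.
  by rewrite integral_distribution.
(* Integrability under the product law is carried over from P through the joint law, as Fubini
   requires. *)
have iZ : (distribution P X \x distribution P Y)%E.-integrable setT f.
  apply/integrableP; split=> //.
  rewrite (eq_measure_integral (distribution P Z)); last by move=> A mA _; exact: prodE.
  rewrite ge0_integral_distribution//; last exact: measurableT_comp.
  by have /integrableP[_] := intf.
rewrite -ZE.
transitivity (\int[(distribution P X \x distribution P Y)%E]_z f z)%E.
  by apply: eq_measure_integral => A mA _; exact/esym/prodE.
by rewrite -integral12_prod_meas1.
Qed.

(** The case f (x, y) = x y of [integral_indep]; square integrability makes the product
    integrable. *)
Lemma expectation_mul_indep (d : measure_display) (T : measurableType d)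
  (R : realType) (P : probability T R) (X Y : T -> R) :
  X \in Lfun P 2%:E -> Y \in Lfun P 2%:E -> indep2 P X Y ->
  'E_P[X \* Y]%E = ('E_P[X] * 'E_P[Y])%E.
Proof.
move=> X2 Y2 indXY.
have Pfin : P setT \is a fin_num := fin_num_measure P _ measurableT.
have /Lfun1_integrable iX := Lfun_subset12 Pfin X2.
have /Lfun1_integrable iY := Lfun_subset12 Pfin Y2.
have /Lfun1_integrable iXY := Lfun2_mul_Lfun1 X2 Y2.
have /[!inE] mX := sub_Lfun_mfun X2.
have /[!inE] mY := sub_Lfun_mfun Y2.
(* Membership in [Lfun] contains measurability, bundled here so that [distribution] applies. *)
pose X' : {mfun T >-> R} := HB.pack X (isMeasurableFun.Build _ _ _ _ X mX).
pose Y' : {mfun T >-> R} := HB.pack Y (isMeasurableFun.Build _ _ _ _ Y mY).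
have jX : (distribution P X').-integrable setT (EFin : R -> \bar R).
  exact: integrable_pushforward.
have jY : (distribution P Y').-integrable setT (EFin : R -> \bar R).
  exact: integrable_pushforward.
have EX : 'E_P[X]%E = (\int[distribution P X']_x x%:E)%E.
  by rewrite integral_distribution// unlock.
have EY : 'E_P[Y]%E = (\int[distribution P Y']_x x%:E)%E.
  by rewrite integral_distribution// unlock.
have fY : (\int[distribution P Y']_x x%:E)%E \is a fin_num.
  exact: integrable_fin_num.
rewrite EX EY -(fineK fY) -integralZr// unlock.
rewrite (@integral_indep _ _ _ _ _ _ _ _ X' Y' (fun z => (z.1 * z.2)%:E))//.
  by apply: eq_integral => x _; rewrite /= (fineK fY) -integralZl.
by apply/measurable_EFinP; apply: measurable_funM;
    [exact: measurable_fst|exact: measurable_snd].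
Qed.

Lemma covariance_indep (d : measure_display) (T : measurableType d)
  (R : realType) (P : probability T R) (X Y : T -> R) :
  X \in Lfun P 2%:E -> Y \in Lfun P 2%:E -> indep2 P X Y ->
  covariance P X Y = 0%E.
Proof.
move=> X2 Y2 indXY.
have Pfin : P setT \is a fin_num := fin_num_measure P _ measurableT.
have X1 := Lfun_subset12 Pfin X2.
have Y1 := Lfun_subset12 Pfin Y2.
rewrite covarianceE ?Lfun2_mul_Lfun1// expectation_mul_indep// subee//.
by rewrite fin_numM// expectation_fin_num.
Qed.

(** Serves to remove the cross term between a partial sum and the next variable. *)
Lemma covariance_suml (d : measure_display) (T : measurableType d)
  (R : realType) (P : probability T R) (X : nat -> T -> R) (Y : T -> R) (k : nat) :
  (forall i, (i < k)%N -> X i \in Lfun P 2%:E) -> Y \in Lfun P 2%:E ->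
  covariance P (\sum_(i < k) X i) Y = (\sum_(i < k) covariance P (X i) Y)%E.
Proof.
move=> + Y2; elim: k => [|k IH] X2.
  by rewrite !big_ord0 -[0]/(cst 0) covariance_cst_l.
rewrite !big_ord_recr/= covarianceDl ?IH ?X2//.
  by move=> i ik; rewrite X2// ltnS ltnW.
by rewrite rpred_sum ?lee1n// => ? i _; apply: X2; rewrite ltnS ltnW.
Qed.

(** Induction with V(S + X) = V(S) + V(X) + 2 Cov(S, X). The added variable has the largest index,
    so pairs i < j suffice. *)
Lemma variance_sum_uncorrelated (d : measure_display) (T : measurableType d)
  (R : realType) (P : probability T R) (X : nat -> T -> R) (k : nat) :
  (forall i, (i < k)%N -> X i \in Lfun P 2%:E) ->
  (forall i j, (i < j < k)%N -> covariance P (X i) (X j) = 0%E) ->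
  'V_P[(\sum_(i < k) X i)%R]%E = (\sum_(i < k) 'V_P[X i])%E.
Proof.
elim: k => [|k IH] X2 cov0.
  by rewrite !big_ord0 -[0]/(cst 0) variance_cst.
have X2' i : (i < k)%N -> X i \in Lfun P 2%:E by move=> ik; rewrite X2// ltnS ltnW.
rewrite !big_ord_recr/= varianceD ?X2//; last first.
  by rewrite rpred_sum ?lee1n// => ? i _; exact: X2'.
rewrite IH//; last by move=> i j /andP[ij jk]; rewrite cov0// ij ltnS ltnW.
rewrite covariance_suml ?X2// [X in (_ * X)%E]big1 ?mule0 ?adde0// => i _.
by rewrite cov0// ltn_ord/=.
Qed.

(** * Bounds uniform in the nodes, and the variance of a weighted sum *)

Lemma jkernel_node_bound (R : realType) (n N : nat) (mu kappa xi beta T e : R) :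
  0 <= e -> - e <= kappa -> - e <= mu ->
  exists2 A : R, 0 <= A & forall m i, (0 < m)%N -> (i <= m)%N ->
    (jkernel n N mu kappa xi beta T (i%:R / m%:R)) ^+ 2 <= A * ((2 * m%:R) `^ e) ^+ 2.
Proof.
move=> e0 ek emu; set p := jkernel _ _ _ _ _ _ _.
have [q Hq] := jkernel_raw_poly R n N mu kappa xi beta T.
have [B HB] := horner_bounded01 R q.
have A0 : 0 <= B ^+ 2 + p 0 ^+ 2 + p 1 ^+ 2 by rewrite !addr_ge0 ?sqr_ge0.
(* One square for the interior nodes and one for each endpoint, so a single constant covers all
   three cases. *)
exists (B ^+ 2 + p 0 ^+ 2 + p 1 ^+ 2) => // m i m0 im.
have m0' : 0 < m%:R :> R by rewrite ltr0n.
(* Since this factor is at least 1, the fixed endpoint values satisfy the same bound. *)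
have W1 : 1 <= ((2 * m%:R) `^ e) ^+ 2.
  rewrite exprn_ege1// -[leLHS](powRr0 (2 * m%:R)) ler_powR//.
  by rewrite -natrM ler1n muln_gt0.
have [->|i0] := posnP i.
  rewrite mul0r (le_trans _ (ler_peMr A0 W1))//.
  by rewrite addrAC lerDr addr_ge0 ?sqr_ge0.
have [->|im'] := eqVneq i m.
  rewrite divff ?gt_eqF// (le_trans _ (ler_peMr A0 W1))//.
  by rewrite lerDr addr_ge0 ?sqr_ge0.
have {im im'} im : (i < m)%N by rewrite ltn_neqAle im' im.
have t0 : 0 < i%:R / m%:R :> R by rewrite divr_gt0// ltr0n.
have t1 : i%:R / m%:R < 1 :> R by rewrite ltr_pdivrMr// mul1r ltr_nat.
rewrite /p /jkernel t0 t1 /= Hq ?t0// exprMn mulrC.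
have j0 : 0 <= jweight mu kappa (i%:R / m%:R) by rewrite mulr_ge0 ?powR_ge0.
have qB : q.[i%:R / m%:R] ^+ 2 <= B ^+ 2.
  have qB : `|q.[i%:R / m%:R]| <= B by rewrite HB ?(ltW t0) ?(ltW t1).
  by rewrite -[leLHS]real_normK ?num_real// ler_sqr ?nnegrE// (le_trans _ qB).
rewrite ler_pM ?sqr_ge0// -?addrA ?ler_wpDr ?addr_ge0 ?sqr_ge0//.
by rewrite ler_sqr ?nnegrE ?powR_ge0// jweight_node_le ?i0.
Qed.

(** Extreme value theorem on [0, L]; it gives one bound for the noise variance at all sampling
    times. *)
Lemma continuous_itvy_bounded (R : realType) (f : R -> R) (L : R) :
  {within `[0, +oo[, continuous f} ->
  exists2 M : R, 0 <= M & forall s, 0 <= s <= L -> f s <= M.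
Proof.
move=> cf; have [L0|L0] := leP 0 L; last first.
  by exists 0 => // s /andP[s0 sL]; have := le_lt_trans (le_trans s0 sL) L0; rewrite ltxx.
have cf' : {within `[0, L], continuous f}.
  apply: continuous_subspaceW cf => x /=.
  by rewrite !in_itv/= andbT => /andP[].
have [c _ Hc] := EVT_max L0 cf'.
exists (Num.max 0 (f c)); first by rewrite le_max lexx.
by move=> s sL; rewrite le_max Hc ?orbT// in_itv.
Qed.

Lemma variance_weighted_sum (d : measure_display) (T : measurableType d)
  (R : realType) (P : probability T R) (c : nat -> R) (X : nat -> T -> R) (k : nat) :
  (forall i, (i < k)%N -> X i \in Lfun P 2%:E) ->
  (forall i j, (i < j < k)%N -> indep2 P (X i) (X j)) ->
  'V_P[(fun w => \sum_(i < k) c i * X i w)%R]%E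
  = (\sum_(i < k) c i ^+ 2 * fine 'V_P[X i]%E)%:E.
Proof.
move=> X2 indX.
have Pfin : P setT \is a fin_num := fin_num_measure P _ measurableT.
have -> : (fun w => \sum_(i < k) c i * X i w) = \sum_(i < k) (c i \o* X i).
  by apply/funext => w; rewrite fct_sumE; apply: eq_bigr => i _; rewrite mulrC.
rewrite (@variance_sum_uncorrelated _ _ _ P (fun i => c i \o* X i)).
- rewrite -sumEFin; apply: eq_bigr => i _.
  by rewrite varianceZ ?X2// [RHS]EFinM fineK// variance_fin_num ?X2.
- by move=> i ik; rewrite Lfun_scale ?X2// ler1n.
- move=> i j /andP[ij jk]; have ik := ltn_trans ij jk.
  have Xi1 := Lfun_subset12 Pfin (X2 _ ik); have Xj1 := Lfun_subset12 Pfin (X2 _ jk).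
  have Xj1' : c j \o* X j \in Lfun P 1 by rewrite Lfun_scale.
  have Xj2' : c j \o* X j \in Lfun P 2%:E by rewrite Lfun_scale ?X2// ler1n.
  have XY1 := Lfun2_mul_Lfun1 (X2 _ ik) (X2 _ jk).
  have XcY1 := Lfun2_mul_Lfun1 (X2 _ ik) Xj2'.
  have indij : indep2 P (X i) (X j) by apply: indX; rewrite ij.
  (* Bilinearity reduces the covariance of the scaled variables to that of the independent ones. *)
  rewrite covarianceZl// covarianceZr//.
  by rewrite (covariance_indep _ _ _ _ _ _ (X2 _ ik) (X2 _ jk) indij) !mule0.
Qed.

(** * Decay of the variance of the noise error *)

Theorem theorem4 (R : realType) (I : set R) (n N : nat) (beta xi t0 Tt mu kappa : R)
  (d : measure_display) (Omega : measurableType d) (P : probability Omega R)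
  (varpi : R -> Omega -> R) (w : nat -> nat -> R) :
  (* I is an open interval contained in [0, +oo) *)
  is_interval I -> open I -> I `<=` `[0, +oo[ ->
  (beta = 1 \/ beta = -1) -> (n <= N)%N -> 0 <= xi <= 1 ->
  t0 \in I -> 0 < Tt -> t0 + beta * Tt \in I ->
  (* the process: square integrable, continuous mean and variance,
     pairwise independent *)
  (forall tau, 0 <= tau -> varpi tau \in Lfun P 2%:E) ->
  {within `[0, +oo[, continuous (fun tau => fine ('E_P[varpi tau])%E)} ->
  {within `[0, +oo[, continuous (fun tau => fine ('V_P[varpi tau])%E)} ->
  (forall s t, 0 <= s -> 0 <= t -> s != t -> indep2 P (varpi s) (varpi t)) ->
  (* the parameters *)
  -(1/2) < kappa -> -(1/2) < mu ->
  (* the quadrature rule *)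
  (forall m i, (0 < m)%N -> (0 < i < m)%N -> 0 < w m i) ->
  (forall m, (0 < m)%N -> 0 <= w m 0%N /\ 0 <= w m m) ->
  (forall m, (0 < m)%N -> kappa < 0 -> w m 0%N = 0) ->
  (forall m, (0 < m)%N -> mu < 0 -> w m m = 0) ->
  (exists C : R, forall m i, (0 < m)%N -> (i <= m)%N -> `|w m i| <= C) ->
  ((fun m : nat => (\sum_(i < m.+1) w m i / m%:R *
        (jkernel n N mu kappa xi beta Tt (i%:R / m%:R)) ^+ 2)%:E)
     @ \oo --> (\int[lebesgue_measure]_(t in `[0%R, 1%R]%classic)
                  ((jkernel n N mu kappa xi beta Tt t) ^+ 2)%:E)%E) ->
  ('V_P[noise_err (jkernel n N mu kappa xi beta Tt) w varpi t0 beta Tt m])%E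
     @[m --> \oo] --> 0%E.
Proof.
move=> _ _ I0 hbeta _ _ /set_mem/I0/=; rewrite in_itv/= andbT => t00 T0.
move=> /set_mem/I0/=; rewrite in_itv/= andbT => t10.
move=> w2 _ cV ind kappa12 mu12 _ _ _ _ [C HC] _.
pose e : R := Num.max 0 (Num.max (- kappa) (- mu)).
have e0 : 0 <= e by rewrite le_max lexx.
have ek : - e <= kappa by rewrite lerNl !le_max lexx/= orbT.
have emu : - e <= mu by rewrite lerNl !le_max lexx !orbT.
(* The condition kappa, mu > -1/2 makes the decay exponent 1 - 2e positive. *)
have e12 : 0 < 1 - 2 * e.
  suff : e < 1 / 2 by lra.
  by rewrite !gt_max; apply/and3P; split; lra.
have [A A0 HA] := jkernel_node_bound R n N mu kappa xi beta Tt e e0 ek emu.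
have [M M0 HM] := continuous_itvy_bounded R _ (t0 + Tt) cV.
pose s m i := t0 + beta * Tt * (i%:R / m%:R) : R.
(* Each sampling time lies between t0 and t0 + beta T, both nonnegative; t0 + T is an upper bound
   for either sign of beta. *)
have s_bnd m i : (0 < m)%N -> (i <= m)%N -> 0 <= s m i <= t0 + Tt.
  move=> m0 im.
  have x0 : 0 <= i%:R / m%:R :> R by rewrite divr_ge0.
  have x1 : i%:R / m%:R <= 1 :> R by rewrite ler_pdivrMr ?ltr0n// mul1r ler_nat.
  rewrite /s; move: (i%:R / m%:R) x0 x1 => x x0 x1.
  by case: hbeta t10 => ->; rewrite ?mul1r ?mulN1r ?mulNr => t10; apply/andP; split; nra.
(* Distinct nodes give distinct times, as pairwise independence demands. *)
have s_inj m i j : (0 < m)%N -> (i < j)%N -> s m i != s m j.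
  move=> m0 ij; rewrite (inj_eq (addrI _)).
  have b0 : beta * Tt != 0.
    by rewrite mulf_neq0 ?(gt_eqF T0)//; case: hbeta => ->; rewrite ?oppr_eq0 oner_eq0.
  rewrite (inj_eq (mulfI b0)) (inj_eq (mulIf _)) ?invr_eq0 ?pnatr_eq0 -?lt0n//.
  by rewrite eqr_nat ltn_eqF.
(* One factor 2 comes from m + 1 <= 2 m, the other from the 2 in (2 m)^(2e - 1). *)
pose K := 4 * C ^+ 2 * A * M.
apply: (@squeeze_cvge _ _ _ _ (fun=> 0%E) _
  (fun m => (K * (2 * m%:R) `^ (- (1 - 2 * e)))%:E)).
- near=> m.
  have m0 : (0 < m)%N by near: m; exact: nbhs_infty_gt.
  have m0' : 0 < m%:R :> R by rewrite ltr0n.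
  rewrite variance_ge0/= (_ : noise_err _ _ _ _ _ _ _ = fun omega => \sum_(i < m.+1)
    (w m i / m%:R * jkernel n N mu kappa xi beta Tt (i%:R / m%:R)) * varpi (s m i) omega)//.
  rewrite (@variance_weighted_sum _ _ _ _
    (fun i => w m i / m%:R * jkernel n N mu kappa xi beta Tt (i%:R / m%:R))
    (fun i => varpi (s m i))); last 2 first.
  + by move=> i im; apply: w2; have /andP[] := s_bnd m i m0 im.
  + move=> i j /andP[ij jm]; apply: ind; last exact: s_inj.
    * by have /andP[] := s_bnd m i m0 (leq_trans (ltnW ij) jm).
    * by have /andP[] := s_bnd m j m0 jm.
  rewrite lee_fin.
  set W := ((2 * m%:R) `^ e) ^+ 2.
  have W0 : 0 <= W by exact: sqr_ge0.
  (* Termwise bound independent of i: C^2/m^2 from the weight, A W from the kernel, M from the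
     noise. *)
  apply: (@le_trans _ _ (\sum_(i < m.+1) (C ^+ 2 / m%:R ^+ 2 * (A * W) * M))).
    apply: ler_sum => i _; have im : (i <= m)%N by rewrite -ltnS.
    rewrite ler_pM ?sqr_ge0 ?fine_ge0 ?variance_ge0 ?HM ?s_bnd//.
    rewrite exprMn ler_pM ?sqr_ge0 ?HA// exprMn exprVn.
    rewrite ler_pM ?sqr_ge0 ?invr_ge0 ?sqr_ge0//.
    by rewrite -real_normK ?num_real// ler_sqr ?nnegrE ?HC// (le_trans _ (HC m i m0 im)).
  rewrite sumr_const card_ord -[leLHS]mulr_natl.
  have -> : (2 * m%:R) `^ (- (1 - 2 * e)) = W / (2 * m%:R).
    have M0' : 0 < 2 * m%:R :> R by rewrite mulr_gt0.
    rewrite opprB powRD; last by apply/implyP => _; rewrite gt_eqF.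
    by rewrite powR_inv1 ?(ltW M0')// [2 * e]mulrC powRrM powR_mulrn ?powR_ge0.
  have -> : K * (W / (2 * m%:R)) = (2 * m%:R) * (C ^+ 2 / m%:R ^+ 2 * (A * W) * M).
    by rewrite /K; field; rewrite gt_eqF.
  have CAW0 : 0 <= C ^+ 2 / m%:R ^+ 2 * (A * W).
    by apply: mulr_ge0; [apply: divr_ge0; exact: sqr_ge0|exact: mulr_ge0].
  apply: ler_wpM2r; first exact: mulr_ge0.
  by rewrite -natrM ler_nat mul2n -addnn -addn1 leq_add2l.
- exact: cvg_cst.
- apply: cvg_EFin; first by near=> m.
  rewrite -[X in _ --> X](mulr0 K).
  apply: cvgM; first exact: cvg_cst.
  exact: cvg_powR_double.
Unshelve. all: by end_near. Qed.
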